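(* Let $G$ be a generator over an alphabet $A$, with sets of locally controllable events $A_{c,i}\subseteq A$ and locally observable events $A_{o,i}\subseteq A$, $i=1,\dots,n$. Let $A_c=\bigcup_i A_{c,i}$, $A_{uc}=A\setminus A_c$, $A_o=\bigcup_i A_{o,i}$, and assume full observations: $A_o=A$. Let $L=L(G)$ and let $K\subseteq L$ be a specification language over $A$. Let $\Sigma_1,\dots,\Sigma_n\subseteq A$ be extensions of $A_{o,1},\dots,A_{o,n}$ such that $K$ is separable with respect to $(A_{o,i}\cup\Sigma_i)_{i=1}^n$. Let $\Sigma_{o,i}=\Sigma_i\cap A_o$ and $\Sigma_{c,i}=\Sigma_i\cap A_c$, and assume $(A_{o,i}\cup\Sigma_{o,i})\cap A_c\subseteq A_{c,i}\cup\Sigma_{c,i}$ for all $i$. Let $P_{i+\Sigma_i}\colon A^*\to(A_{o,i}\cup\Sigma_i)^*$ be the projection and let $$\sup\mathrm{C}_{i+\Sigma_i}=\sup\mathrm{C}\bigl(P_{i+\Sigma_i}(K),P_{i+\Sigma_i}(L),(A_{o,i}\cup\Sigma_i)\cap A_{uc}\bigr).$$ If every projection $P_{i+\Sigma_i}$ is an $L$-observer and locally control consistent (LCC) for $L$, and the languages $\sup\mathrm{C}_{i+\Sigma_i}$ are synchronously nonconflicting (e.g., prefix-closed), then $$\parallel_{i=1}^n\sup\mathrm{C}_{i+\Sigma_i}=\sup\mathrm{C}(K,L,A_{uc}),$$ and this language is coobservable with respect to $L$ and $(A_{o,i}\cup\Sigma_{o,i})_{i=1}^n$.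
   Context: An alphabet is a finite nonempty set of events; all languages are assumed regular. A generator $G=(Q,A,f,q_0,Q_m)$ is a deterministic finite automaton with partial transition function $f$; its generated language is $L(G)=\{s\in A^*\mid f(q_0,s)\text{ is defined}\}$, which is prefix-closed. $\overline{L}$ denotes the prefix closure of $L$; $L$ is prefix-closed if $L=\overline L$. For $Y\subseteq X$, the projection $X^*\to Y^*$ is the monoid morphism erasing the events of $X\setminus Y$ and keeping those of $Y$. For $L_i\subseteq X_i^*$, $X=\bigcup_i X_i$, the synchronous product is $\parallel_i L_i=\bigcap_i P_i^{-1}(L_i)\subseteq X^*$, with $P_i\colon X^*\to X_i^*$ the projections. Languages $L_i$ are synchronously nonconflicting if $\overline{\parallel_i L_i}=\parallel_i\overline{L_i}$. $K\subseteq X^*$ is separable with respect to $(X_i)_i$ if $K=\parallel_i P_i(K)$. For a prefix-closed $N\subseteq X^*$ and $X_{uc}\subseteq X$, a language $M\subseteq N$ is controllable with respect to $N$ and $X_{uc}$ if $\overline{M}X_{uc}\cap N\subseteq\overline{M}$. $\sup\mathrm{C}(M,N,X_{uc})$ denotes the supremal (largest) sublanguage of $M$ that is controllable with respect to $N$ and $X_{uc}$ (it exists, since controllability is preserved by unions). For $A_k\subseteq A$, a projection $P_k\colon A^*\to A_k^*$ is an $L$-observer for $L\subseteq A^*$ if for all $s\in\overline{L}$ and all $t$, if $P_k(s)t\in P_k(L)$, then there exists $u\in A^*$ such that $su\in L$ and $P_k(u)=t$. For prefix-closed $L\subseteq A^*$, $P_k$ is LCC with respect to a word $s\in L$ if for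 all $a_u\in A_k\cap A_{uc}$ with $P_k(s)a_u\in P_k(L)$, either there is no $u\in(A\setminus A_k)^*$ with $sua_u\in L$, or there is $u\in(A_{uc}\setminus A_k)^*$ with $sua_u\in L$. $P_k$ is LCC for $L$ if it is LCC with respect to every $s\in L$. Given local observable alphabets $O_i\subseteq A$ and local controllable alphabets $C_i\subseteq A$ with $\bigcup_i C_i=A_c$, a language $M\subseteq L$ is coobservable with respect to $L$ and $(O_i)_{i=1}^n$ if for all $s\in\overline{M}$ and $a\in A_c$ with $sa\in L\setminus\overline{M}$ there is $i$ such that $a\in C_i$ and $Q_i^{-1}(Q_i(s))\{a\}\cap\overline{M}=\emptyset$, where $Q_i\colon A^*\to O_i^*$ is the projection. Here $O_i=A_{o,i}\cup\Sigma_{o,i}$ and the (extended) local controllable alphabets are $C_i=A_{c,i}\cup\Sigma_{c,i}$. *)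

(* Defs.v *)
(* Mathematical Components, with sets of words from mathcomp-classical. *)
From HB Require Import structures.
From mathcomp Require Import all_boot.
From mathcomp Require Import boolp classical_sets.

Set Implicit Arguments.
Unset Strict Implicit.
Unset Printing Implicit Defensive.

Local Open Scope classical_set_scope.

(* Languages over a sub-alphabet X : {set A} are represented as sets of words
   over the ambient alphabet A all of whose letters lie in X; a projection
   X^* -> Y^* is then the restriction of a single function on seq A. *)
Definition lang (A : finType) := set (seq A).

Record generator (A : finType) := Generator {
  gstate : finType;
  gtrans : gstate -> A -> option gstate;
  ginit : gstate;
  gmarked : {set gstate}
}.

Fixpoint grun (A : finType) (G : generator A) (q : gstate G) (s : seq A) :
    option (gstate G) :=
  if s is a :: s' then
    if gtrans q a is Some q' then grun q' s' else None
  else Some q.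

Definition gen_lang (A : finType) (G : generator A) : lang A :=
  [set s | exists q, grun (ginit G) s = Some q].

Definition marked_lang (A : finType) (G : generator A) : lang A :=
  [set s | exists2 q, grun (ginit G) s = Some q & q \in gmarked G].

Definition regular (A : finType) (K : lang A) : Prop :=
  exists G : generator A, K = marked_lang G.

Definition pclosure (A : finType) (K : lang A) : lang A :=
  [set s | exists t, K (s ++ t)].

Definition prefix_closed (A : finType) (K : lang A) : Prop := K = pclosure K.

Definition proj (A : finType) (Y : {set A}) (s : seq A) : seq A :=
  [seq a <- s | a \in Y].

Definition sync (A : finType) (n : nat) (X : 'I_n -> {set A})
    (K : 'I_n -> lang A) : lang A :=
  [set s | all (mem (\bigcup_i X i)%SET) s /\ forall i, K i (proj (X i) s)].

Definition sync_nonconflicting (A : finType) (n : nat) (X : 'I_n -> {set A})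
    (K : 'I_n -> lang A) : Prop :=
  pclosure (sync X K) = sync X (fun i => pclosure (K i)).

Definition separable (A : finType) (n : nat) (X : 'I_n -> {set A})
    (K : lang A) : Prop :=
  K = sync X (fun i => proj (X i) @` K).

(* The notion is meant for prefix-closed N. *)
Definition controllable (A : finType) (N : lang A) (U : {set A})
    (M : lang A) : Prop :=
  M `<=` N /\
  forall s a, pclosure M s -> a \in U -> N (rcons s a) -> pclosure M (rcons s a).

Definition supC (A : finType) (M N : lang A) (U : {set A}) : lang A :=
  \bigcup_(M' in [set M' | M' `<=` M /\ controllable N U M']) M'.

Definition observer (A : finType) (Ak : {set A}) (L : lang A) : Prop :=
  forall s t, pclosure L s -> (proj Ak @` L) (proj Ak s ++ t) ->
    exists u, L (s ++ u) /\ proj Ak u = t.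

(* The notions lcc_at and lcc are meant for prefix-closed L. *)
Definition lcc_at (A : finType) (Auc Ak : {set A}) (L : lang A)
    (s : seq A) : Prop :=
  forall a, a \in Ak :&: Auc -> (proj Ak @` L) (rcons (proj Ak s) a) ->
    ~ (exists u, all (mem (~: Ak)) u /\ L (s ++ rcons u a)) \/
    (exists u, all (mem (Auc :\: Ak)) u /\ L (s ++ rcons u a)).

Definition lcc (A : finType) (Auc Ak : {set A}) (L : lang A) : Prop :=
  forall s, L s -> lcc_at Auc Ak L s.

(* The set of controllable events is the union of the C i. *)
Definition coobservable (A : finType) (n : nat) (L : lang A)
    (O C : 'I_n -> {set A}) (M : lang A) : Prop :=
  M `<=` L /\
  forall s a, pclosure M s -> a \in (\bigcup_i C i)%SET ->
    L (rcons s a) -> ~ pclosure M (rcons s a) ->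
    exists i, a \in C i /\
      [set rcons s' a | s' in proj (O i) @^-1` [set proj (O i) s]]
        `&` pclosure M = set0.

Lemma gen_lang_prefix_closed (A : finType) (G : generator A) :
  prefix_closed (gen_lang G).
Proof.
rewrite /prefix_closed; apply/seteqP; split=> s /=.
  by move=> Ls; exists [::]; rewrite cats0.
case=> t; rewrite /gen_lang /=; elim: s (ginit G) => [|a s IHs] q /=.
  by move=> _; exists q.
by case: (gtrans q a) => [q'|]; [exact: IHs | case].
Qed.

Lemma proj_prefix_closed (A : finType) (Y : {set A}) (L : lang A) :
  prefix_closed L -> prefix_closed (proj Y @` L).
Proof.
move=> pL; rewrite /prefix_closed; apply/seteqP; split=> s /=.
  by move=> Ls; exists [::]; rewrite cats0.
case=> t [w Lw]; elim: w s L pL Lw => [|a w IHw] s L pL Lw /=.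
  by case: s => // _; exists [::].
have L0 : L [::] by rewrite pL; exists (a :: w).
have pLa : prefix_closed [set v | L (a :: v)].
  rewrite /prefix_closed; apply/seteqP; split=> v /=.
    by move=> Lv; exists [::]; rewrite cats0.
  by case=> v' Lv; rewrite pL; exists v'.
have IH s1 := IHw s1 _ pLa Lw.
case: ifP => aY.
  case: s => [|b s] /=; first by exists [::].
  by case=> <- /IH[v Lv <-]; exists (a :: v); rewrite //= aY.
by move=> /IH[v Lv <-]; exists (a :: v); rewrite //= aY.
Qed.

Lemma supC_sub (A : finType) (M N : lang A) (U : {set A}) :
  supC M N U `<=` M.
Proof. by move=> s [M' [M'M _] /M'M]. Qed.

Lemma supC_controllable (A : finType) (M N : lang A) (U : {set A}) :
  controllable N U (supC M N U).
Proof.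
split=> [s [M' [_ [M'N _]] /M'N]//|s a [t [M' [M'M cM'] M't]] aU Nsa].
have [|t' M't'] := cM'.2 s a _ aU Nsa; first by exists t.
by exists t', M'.
Qed.

Lemma supC_max (A : finType) (M N : lang A) (U : {set A}) (M' : lang A) :
  M' `<=` M -> controllable N U M' -> M' `<=` supC M N U.
Proof. by move=> M'M cM' s M's; exists M'. Qed.

Lemma prefix_closed_nonconflicting (A : finType) (n : nat)
    (X : 'I_n -> {set A}) (K : 'I_n -> lang A) :
  (forall i, prefix_closed (K i)) -> sync_nonconflicting X K.
Proof.
move=> pK; rewrite /sync_nonconflicting; apply/seteqP; split=> s /=.
  case=> t [+ Kst]; rewrite all_cat => /andP[Xs _]; split=> // i.
  by exists (proj (X i) t); rewrite /proj -filter_cat; apply: Kst.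
by case=> Xs Ks; exists [::]; rewrite cats0; split=> // i; rewrite pK.
Qed.

(* Main.v *)
Require Import Defs.
From HB Require Import structures.
From mathcomp Require Import all_boot.
From mathcomp Require Import boolp classical_sets.

(** Controllability and coobservability speak of the prefix closure of a
    language, and nonconflictingness is what allows them to be checked component
    by component when the language is a synchronous product: a word
    belongs to the closure of the synchronous product exactly when each of its
    projections belongs to the closure of the corresponding component.

    Given this, the product of controllable components is controllable
    ([sync_controllable]): an uncontrollable continuation in the plant projects
    either to an uncontrollable continuation in the projected plant or to no
    continuation at all. The product lies in the specification by separability,
    hence in its supremal controllable sublanguage.

    Conversely, the projection of a controllable language is controllable
    ([proj_controllable]). An uncontrollable event enabled after the projection
    of a word is, by the observer property, reachable from the word itself
    through erased events; by local control consistency these erased events can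
    be taken uncontrollable; controllability then keeps the whole detour inside
    the closure. So every projection of the global supremal language lies in
    the local supremal language.

    For coobservability ([sync_coobservable]), a word that leaves the closure
    of the product does so in some component. The last event is then visible to
    that component, which controls every controllable event it observes, and the
    violation depends only on the projection of the word, so that it occurs for
    all lookalikes. *)

Set Implicit Arguments.
Unset Strict Implicit.
Unset Printing Implicit Defensive.

Local Open Scope classical_set_scope.

Lemma pclosure_prefix (A : finType) (M : lang A) s t :
  pclosure M (s ++ t) -> pclosure M s.
Proof. by case=> w Mw; exists (t ++ w); rewrite catA. Qed.

Lemma pclosure_prefix_closed (A : finType) (M : lang A) :
  prefix_closed (pclosure M).
Proof.
apply/seteqP; split=> s; first by move=> Ms; exists [::]; rewrite cats0.
by case=> t; exact: pclosure_prefix.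
Qed.

Lemma pclosure_sub (A : finType) (M L : lang A) :
  prefix_closed L -> M `<=` L -> pclosure M `<=` L.
Proof. by move=> pL ML s [t /ML Lst]; rewrite pL; exists t. Qed.

Lemma proj_cat (A : finType) (Y : {set A}) s t :
  proj Y (s ++ t) = proj Y s ++ proj Y t.
Proof. exact: filter_cat. Qed.

Lemma proj_rcons (A : finType) (Y : {set A}) s a :
  proj Y (rcons s a) = if a \in Y then rcons (proj Y s) a else proj Y s.
Proof. exact: filter_rcons. Qed.

Lemma proj_eq0 (A : finType) (Y : {set A}) u :
  (proj Y u == [::]) = all (mem (~: Y)) u.
Proof.
rewrite -size_eq0 size_filter -leqn0 leqNgt -has_count -all_predC.
by apply: eq_all => a; rewrite /= inE.
Qed.

(** A cut point of the projected word lifts to a cut point of the word: this is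
    the prefix-closedness of the projection of [pclosure M]. *)
Lemma pclosure_proj (A : finType) (Y : {set A}) (M : lang A) :
  pclosure (proj Y @` M) = proj Y @` pclosure M.
Proof.
apply/seteqP; split=> s.
  case=> t [w Mw ws]; rewrite (proj_prefix_closed Y (pclosure_prefix_closed M)).
  by exists t, w => //; exists [::]; rewrite cats0.
by case=> w [t Mwt] <-; exists (proj Y t), (w ++ t) => //; rewrite proj_cat.
Qed.

Lemma proj_eq1 (A : finType) (Y : {set A}) u a :
  proj Y u = [:: a] ->
  exists u1 u2, u = u1 ++ a :: u2 /\ all (mem (~: Y)) u1.
Proof.
move=> ua.
have /andP[aY] : (a \in Y) && (a \in u) by rewrite -mem_filter -/(proj Y u) ua mem_head.
move=> au; case/splitPr: au ua => u1 u2 ua; exists u1, u2; split=> //.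
move: ua; rewrite -proj_eq0 proj_cat /= aY.
by case: (proj Y u1) => // b [].
Qed.

(** Controllability propagates along words: induction on one-event steps, the
    intermediate plant words being supplied by prefix closure. *)
Lemma controllable_cat (A : finType) (N M : lang A) (U : {set A}) s u :
  prefix_closed N -> controllable N U M -> pclosure M s ->
  all (mem U) u -> N (s ++ u) -> pclosure M (s ++ u).
Proof.
move=> pN [_ cM] Ms; elim/last_ind: u => [|u a IHu]; first by rewrite cats0.
rewrite all_rcons -rcons_cat => /andP[aU uU] Nua.
apply: cM => //; apply: IHu => //.
by rewrite pN; exists [:: a]; rewrite cats1.
Qed.

(** The observer property lifts the projected event to a plant path through
    erased events, and local control consistency makes those events
    uncontrollable, so that the controllable language must contain the path. *)
Lemma proj_controllable (A : finType) (L M : lang A) (Auc Y : {set A}) :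
  prefix_closed L -> observer Y L -> lcc Auc Y L -> controllable L Auc M ->
  controllable (proj Y @` L) (Y :&: Auc) (proj Y @` M).
Proof.
move=> pL obsY lccY cM; have ML := cM.1; split; first exact: image_subset.
move=> s' a; rewrite pclosure_proj => -[s Ms <-{s'}] aYuc PLsa.
have Ls : L s := pclosure_sub pL ML Ms.
have [aY aUc] : a \in Y /\ a \in Auc by exact/setIP.
have [v [Lsv /proj_eq1[u1 [u2 [vE u1Y]]]]] :
    exists v, L (s ++ v) /\ proj Y v = [:: a].
  by apply: obsY; rewrite -?pL ?cats1.
have Lsu1 : L (s ++ rcons u1 a).
  by rewrite pL; exists u2; rewrite -catA cat_rcons -vE.
have [[]|[u [uUc Lsua]]] := lccY s Ls a aYuc PLsa; first by exists u1.
have [uU uY] : all (mem Auc) u /\ proj Y u = [::].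
  split; last apply/eqP; rewrite ?proj_eq0; apply: sub_all uUc => b;
  by rewrite /= !inE => /andP[].
exists (s ++ rcons u a).
  by apply: (controllable_cat pL cM) => //; rewrite all_rcons uU andbT.
by rewrite proj_cat proj_rcons aY uY cats1.
Qed.

Lemma sync_setT (A : finType) (n : nat) (X : 'I_n -> {set A})
    (K : 'I_n -> lang A) s :
  (\bigcup_i X i)%SET = [set: A]%SET ->
  sync X K s <-> forall i, K i (proj (X i) s).
Proof.
move=> XT; split=> [[]//|Ks]; split=> //.
by apply/allP=> a _; rewrite /= XT inE.
Qed.

(** Nonconflictingness reduces membership in the closure of the product to the
    components; a component that does not see the event does not move. *)
Lemma sync_controllable (A : finType) (n : nat) (X : 'I_n -> {set A})
    (M : 'I_n -> lang A) (L : lang A) (U : {set A}) :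
  (\bigcup_i X i)%SET = [set: A]%SET -> sync_nonconflicting X M ->
  (forall i, controllable (proj (X i) @` L) (X i :&: U) (M i)) ->
  sync X M `<=` L -> controllable L U (sync X M).
Proof.
move=> XT ncM cM ML; split=> // s a; rewrite ncM !sync_setT // => Ms aU Lsa i.
rewrite proj_rcons; case: ifPn => // aX; apply: (cM i).2 => //.
  by rewrite inE aX.
by exists (rcons s a) => //; rewrite proj_rcons aX.
Qed.

(** The component in which the extended word leaves the closure sees the last
    event, hence may disable it, and it cannot tell lookalike words apart. *)
Lemma sync_coobservable (A : finType) (n : nat) (X C : 'I_n -> {set A})
    (M : 'I_n -> lang A) (L : lang A) :
  (\bigcup_i X i)%SET = [set: A]%SET -> sync_nonconflicting X M ->
  (forall i, X i :&: (\bigcup_j C j)%SET \subset C i) ->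
  sync X M `<=` L -> coobservable L X C (sync X M).
Proof.
move=> XT ncM XC ML; split=> // s a; rewrite ncM !sync_setT // => Ms aC _.
move/existsNP=> [i]; rewrite proj_rcons; case: ifPn => // aX nMsa.
exists i; split; first by apply: (fintype.subsetP (XC i)); rewrite inE aX.
apply/seteqP; split=> // _ [[s' /= s's <-]].
by rewrite sync_setT // => /(_ i); rewrite proj_rcons aX s's.
Qed.

Theorem theorem11 (A : finType) (A_nonempty : 0 < #|A|)
    (G : generator A) (n : nat) (Aci Aoi : 'I_n -> {set A})
    (K : lang A) (Sigma : 'I_n -> {set A}) :
  let Ac := (\bigcup_i Aci i)%SET in
  let Auc := ~: Ac in
  let Ao := (\bigcup_i Aoi i)%SET in
  let L := gen_lang G in
  let OS := fun i => Aoi i :|: Sigma i in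
  let Sigmao := fun i => Sigma i :&: Ao in
  let Sigmac := fun i => Sigma i :&: Ac in
  let O := fun i => Aoi i :|: Sigmao i in
  let C := fun i => Aci i :|: Sigmac i in
  let supCi := fun i =>
    supC (proj (OS i) @` K) (proj (OS i) @` L) (OS i :&: Auc) in
  Ao = [set: A]%SET ->
  regular K ->
  K `<=` L ->
  separable OS K ->
  (forall i, O i :&: Ac \subset C i) ->
  (forall i, observer (OS i) L) ->
  (forall i, lcc Auc (OS i) L) ->
  sync_nonconflicting OS supCi ->
  sync OS supCi = supC K L Auc /\
  coobservable L O C (sync OS supCi).
Proof.
move=> Ac Auc Ao L OS Sigmao Sigmac O C supCi AoT _ KL sepK OC obs lccL ncS.
have OE : O = OS by apply/funext=> i; rewrite /O /Sigmao AoT finset.setIT.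
have XT : (\bigcup_i OS i)%SET = [set: A]%SET.
  apply/setP=> a; rewrite inE; have : a \in Ao by rewrite AoT inE.
  case/bigcupP=> i _ aAo; apply/bigcupP; exists i => //.
  by rewrite inE aAo.
(* The extended alphabets add no controllable events globally. *)
have CE : (\bigcup_i C i)%SET = Ac.
  apply/setP=> a; apply/bigcupP/bigcupP=> -[i _].
    by rewrite !inE => /orP[aAc|/andP[_ /bigcupP]//]; exists i.
  by move=> aAc; exists i; rewrite // inE aAc.
have pL : prefix_closed L := gen_lang_prefix_closed G.
have SK : sync OS supCi `<=` K.
  move=> s; rewrite sepK !sync_setT // => Ss i; exact: supC_sub (Ss i).
have SL := subset_trans SK KL.
split; last first.
  by rewrite OE; apply: sync_coobservable => // i; rewrite CE -OE.
apply/seteqP; split.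
  apply: supC_max => //; apply: sync_controllable => // i.
  exact: supC_controllable.
move=> s Ts; rewrite sync_setT // => i.
apply: (supC_max (M' := proj (OS i) @` supC K L Auc)); last by exists s.
  by apply: image_subset; exact: supC_sub.
by apply: proj_controllable => //; exact: supC_controllable.
Qed.
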